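(* If a symmetric Markov semigroup $(T_t)_{t\ge0}$ has a simple generator $L=Id-\mathbb{E}$, or is a tensor product of such simple semigroups, then for all real $q<p<1$, every strictly positive function $f$ on the underlying space, and all $t\ge\log\frac{1-q}{1-p}$ we have $$\|T_tf\|_q\ge\|f\|_p.$$
   Context: $(\Omega,\mu)$ is a finite probability space with $\mu\{\omega\}>0$ for all $\omega$, and $\mathbb{E}f=\int_\Omega f\,d\mu$. Simple semigroup: $L=Id-\mathbb{E}$, $T_t=e^{-tL}$, i.e. $T_tf=e^{-t}f+(1-e^{-t})\mathbb{E}f$. Tensor product of simple semigroups: given finite probability spaces $(\Omega_i,\mu_i)$, $1\le i\le n$ (all atoms of positive mass), with simple semigroups $T^{(i)}_t=e^{-t(Id-\mathbb{E}_{\mu_i})}$, one takes $(\Omega,\mu)=(\prod_i\Omega_i,\bigotimes_i\mu_i)$ and $T_t=\bigotimes_{i=1}^nT^{(i)}_t$. For strictly positive $f$: $\|f\|_p=(\mathbb{E}f^p)^{1/p}$ for real $p\ne0$, and $\|f\|_0=\exp(\mathbb{E}\log f)$. *)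

(* Defs.v *)
From HB Require Import structures.
From mathcomp Require Import all_boot all_order all_algebra.
From mathcomp Require Import all_classical all_reals all_analysis.

Set Implicit Arguments.
Unset Strict Implicit.
Unset Printing Implicit Defensive.

Import Order.TTheory GRing.Theory Num.Theory.
Import numFieldNormedType.Exports.

Local Open Scope ring_scope.

Record finProbSpace (R : realType) := FinProbSpace {
  points :> finType;
  mass : points -> R;
  mass_gt0 : forall x, 0 < mass x;
  mass_sum1 : \sum_x mass x = 1 }.

Arguments mass {R} P x : rename.
Arguments mass_gt0 {R} P x : rename.
Arguments mass_sum1 {R} P : rename.

Definition expect (R : realType) (P : finProbSpace R) (f : P -> R) : R :=
  \sum_x f x * mass P x.

(* Meant for f > 0, where the value for p = 0 is the limit of the others. *)
Definition pnorm (R : realType) (P : finProbSpace R) (p : R) (f : P -> R) : R :=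
  if p == 0 then expR (expect (fun x => ln (f x)))
  else expect (fun x => f x `^ p) `^ p^-1.

(* e^A = sum_k A^k / k!, evaluated pointwise. *)
Definition op_exp (R : realType) (X : Type) (A : (X -> R) -> (X -> R))
    (f : X -> R) (x : X) : R :=
  limn (series (fun k => iter k A f x / k`!%:R)).

Definition simple_generator (R : realType) (P : finProbSpace R)
    (f : P -> R) (x : P) : R :=
  f x - expect f.

Definition simple_semigroup (R : realType) (P : finProbSpace R) (t : R)
    : (P -> R) -> (P -> R) :=
  op_exp (fun f x => - t * simple_generator f x).

Section ProductSpace.
Context (R : realType) (n : nat) (P : 'I_n -> finProbSpace R).

Definition prod_points : finType := {dffun forall i : 'I_n, P i}.

Definition prod_mass (w : prod_points) : R := \prod_i mass (P i) (w i).

Lemma sum_prod_points (F : forall i, P i -> R) :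
  \sum_(w : prod_points) \prod_i F i (w i) = \prod_i \sum_x F i x.
Proof.
rewrite (reindex (@dffun_of_fprod _ P)); last first.
  exact/onW_bij/dffun_of_fprod_bij.
pose G i := [ffun x => F i x].
transitivity (\sum_(w : fprod P) \prod_i G i (w i)).
  by apply: eq_bigr => w _; apply: eq_bigr => i _; rewrite !ffunE.
rewrite big_fprod.
transitivity (\prod_i \sum_(x : P i) G i x); last first.
  by apply: eq_bigr => i _; apply: eq_bigr => x _; rewrite ffunE.
rewrite [RHS](eq_bigr _ (fun i _ => big_tag (fun i => G i : P i -> R) i)).
by rewrite bigA_distr_big_dep.
Qed.

Lemma prod_mass_gt0 w : 0 < prod_mass w.
Proof. by apply: prodr_gt0 => i _; exact: mass_gt0. Qed.

Lemma prod_mass_sum1 : \sum_w prod_mass w = 1.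
Proof.
by rewrite (sum_prod_points (fun i => mass (P i))) big1 // => i _; exact: mass_sum1.
Qed.

Definition prod_space : finProbSpace R :=
  FinProbSpace prod_mass_gt0 prod_mass_sum1.

Definition indic_pt (X : finType) (y x : X) : R := (x == y)%:R.

(* Expand f on the product basis indic_pt (v 0) (x) ... (x) indic_pt (v (n-1)),
   v in prod_space, and apply A i to the i-th factor of each basis element. *)
Definition tensor_op (A : forall i, (P i -> R) -> (P i -> R))
    (f : prod_space -> R) (w : prod_space) : R :=
  \sum_(v : prod_space) f v * \prod_i A i (indic_pt (v i)) (w i).

Definition tensor_semigroup (t : R) : (prod_space -> R) -> (prod_space -> R) :=
  tensor_op (fun i => simple_semigroup (P := P i) t).

End ProductSpace.

Lemma simple_semigroupE (R : realType) (P : finProbSpace R) (t : R)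
    (f : P -> R) (x : P) :
  simple_semigroup t f x = expR (- t) * f x + (1 - expR (- t)) * expect f.
Proof.
pose L := @simple_generator R P.
have EL g : expect (L g) = 0.
  rewrite /L /expect /simple_generator.
  under eq_bigr => y _ do rewrite mulrBl.
  by rewrite big_split /= sumrN -mulr_sumr mass_sum1 mulr1 subrr.
have EZ c g : expect (fun y => c * g y) = c * expect g.
  by rewrite /expect mulr_sumr; apply: eq_bigr => y _; rewrite mulrA.
have itE k : iter k.+1 (fun g y => - t * L g y) f
    = fun y => (- t) ^+ k.+1 * L f y.
  elim: k => [|k IH]; first by apply/funext => y /=; rewrite expr1.
  rewrite iterS IH; apply/funext => y.
  by rewrite /L /simple_generator -/(L f) EZ EL mulr0 subr0 mulrA -exprS.
have -> : expR (- t) * f x + (1 - expR (- t)) * expect f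
    = expR (- t) * L f x + expect f.
  by rewrite /L /simple_generator mulrBr mulrBl mul1r addrA addrAC.
rewrite /simple_semigroup /op_exp -/L.
set u := (X in series X).
have -> : u = (fun k => exp_coeff (- t) k * L f x + (k == 0%N)%:R * expect f).
  apply/funext => -[|k]; rewrite /u /exp_coeff.
    by rewrite /= fact0 invr1 !mulr1 !mul1r /L /simple_generator subrK.
  by rewrite itE mul0r addr0 mulrAC.
apply: cvg_lim => //.
have -> : series (fun k => exp_coeff (- t) k * L f x + (k == 0%N)%:R * expect f)
   = (fun N => series (exp_coeff (- t)) N * L f x
             + series (fun k => (k == 0%N)%:R * expect f) N).
  by apply/funext => N; rewrite /series /= big_split /= mulr_suml.
apply: cvgD; first by apply: cvgMl; exact: is_cvg_series_exp_coeff.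
rewrite -cvg_shiftS; apply: cvg_near_cst; apply: nearW => N /=.
by rewrite /series /= big_nat_recl //= mul1r big1 ?addr0 // => i _; rewrite mul0r.
Qed.

Lemma tensor_opE (R : realType) (n : nat) (P : 'I_n -> finProbSpace R)
    (A : forall i, (P i -> R) -> (P i -> R)) (g : forall i, P i -> R)
    (w : prod_space P) :
  (forall i (h : P i -> R) x, A i h x = \sum_y h y * A i (indic_pt R y) x) ->
  tensor_op A (fun v => \prod_i g i (v i)) w = \prod_i A i (g i) (w i).
Proof.
move=> linA; rewrite /tensor_op.
transitivity (\sum_(v : prod_space P) \prod_i
    (g i (v i) * A i (indic_pt R (v i)) (w i))).
  by apply: eq_bigr => v _; rewrite big_split.
rewrite (sum_prod_points (fun i y => g i y * A i (indic_pt R y) (w i))).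
by apply: eq_bigr => i _; rewrite -linA.
Qed.

(* Main.v *)
Require Import Defs.
From mathcomp Require Import all_boot all_order all_algebra.
From mathcomp Require Import all_classical all_reals all_analysis.
From mathcomp Require Import ring lra.

(** Write N(p, f) for the norm of exponent p and r = q / (q - 1) for the
    exponent conjugate to q.

    On a single space, follow the norm of T_s f along the curve of exponents
    q(s) = 1 - (1 - p) e^(c s), where c <= 1 is chosen so that q(t) = q.  The
    derivative in s of ln N(q(s), T_s f) is a positive multiple of
      Y - c (1 - q(s)) / q(s)^2 Ent(g),    with g = (T_s f)^q(s),
    where Y = E(h) E(h^(q(s) - 1)) - E(h^q(s)) for h = T_s f is minus the
    covariance of h and h^(q(s) - 1), hence nonnegative.  So the norm does not
    decrease as soon as the logarithmic Sobolev inequality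
      (1 - q) / q^2 Ent(h^q) <= E(h) E(h^(q-1)) - E(h^q)    (q < 1, q <> 0)
    holds ([log_sobolev]).  For the generator Id - E this is elementary: by
    Jensen, Ent(g) <= Cov(g, ln g), and two covariances are compared by comparing
    the integrands at every pair of points.  With x - y = 2 u, where e^x and e^y
    are the two values of h, what remains is
      (1 - q) u sinh(q u) / q <= sinh u sinh((1 - q) u),
    a consequence of the convexity of sinh on the half-line
    ([sinh_product_ge]).

    This argument needs q(s) <> 0, so it covers the case where p and q are on
    the same side of 0.  The cases p = 0 and q = 0 follow by continuity of the
    norm at exponent 0, and q < 0 < p by composing the flow from p to 0 with the
    flow from 0 to q ([simple_reverse_hypercontractive]).

    For products, the reverse Hoelder inequality and its equality case turn
    N(p, f) <= N(q, T f) into the bilinear inequality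
      N(p, f) N(r, g) <= E(g T f)    for all g > 0
    ([reverse_hoelder], [pnorm_ge_dual]).  In this form the inequality passes to
    products by applying it in one coordinate at a time, because the norm on a
    product is an iterated norm ([reverse_bilinear_prod]). *)

Set Implicit Arguments.
Unset Strict Implicit.
Unset Printing Implicit Defensive.

Import Order.TTheory GRing.Theory Num.Theory.
Import numFieldNormedType.Exports.

Local Open Scope ring_scope.

Lemma le_of_eq (R : realType) (x y : R) : x = y -> x <= y.
Proof. by move=> ->. Qed.

(** * Expectations on a finite probability space *)

Lemma expectD (R : realType) (P : finProbSpace R) (f g : P -> R) :
  expect (fun x => f x + g x) = expect f + expect g.
Proof.
by rewrite /expect -big_split; apply: eq_bigr => x _; rewrite mulrDl.
Qed.

Lemma expectZ (R : realType) (P : finProbSpace R) (c : R) (f : P -> R) :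
  expect (fun x => c * f x) = c * expect f.
Proof. by rewrite /expect mulr_sumr; apply: eq_bigr => x _; rewrite mulrA. Qed.

Lemma expect_cst (R : realType) (P : finProbSpace R) (c : R) :
  expect (fun _ : P => c) = c.
Proof. by rewrite /expect -mulr_sumr mass_sum1 mulr1. Qed.

Lemma eq_expect (R : realType) (P : finProbSpace R) (f g : P -> R) :
  f =1 g -> expect f = expect g.
Proof. by move=> fg; apply: eq_bigr => x _; rewrite fg. Qed.

Lemma ler_expect (R : realType) (P : finProbSpace R) (f g : P -> R) :
  (forall x, f x <= g x) -> expect f <= expect g.
Proof. by move=> fg; apply: ler_sum => x _; rewrite ler_pM2r ?mass_gt0. Qed.

Lemma expect_gt0 (R : realType) (P : finProbSpace R) (f : P -> R) :
  (forall x, 0 < f x) -> 0 < expect f.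
Proof.
move=> f0; have fm x : 0 < f x * mass P x by rewrite mulr_gt0 ?mass_gt0.
rewrite lt0r sumr_ge0 => [|x _]; last exact: ltW.
rewrite andbT psumr_eq0 => [|x _]; last exact: ltW.
apply/negP => /allP none; have := mass_sum1 P.
rewrite big1 => [/eqP|x _]; first by rewrite eq_sym oner_eq0.
by have := none x (mem_index_enum x); rewrite gt_eqF.
Qed.

(** Twice the covariance of F and G is the mean of (F x - F y) (G x - G y) over
    independent x and y, so covariances can be compared pair by pair. *)
Lemma ler_covariance (R : realType) (P : finProbSpace R) (F G F' G' : P -> R) :
  (forall x y, (F x - F y) * (G x - G y) <= (F' x - F' y) * (G' x - G' y)) ->
  expect (fun x => F x * G x) - expect F * expect G <=
  expect (fun x => F' x * G' x) - expect F' * expect G'.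
Proof.
have cov2 (U V : P -> R) :
    expect (fun x => expect (fun y => (U x - U y) * (V x - V y)))
    = 2 * (expect (fun x => U x * V x) - expect U * expect V).
  transitivity (expect (fun x => U x * V x + ((- expect V) * U x +
      ((- expect U) * V x + expect (fun y => U y * V y))))).
    apply: eq_expect => x.
    transitivity (expect (fun y => U x * V x + ((- U x) * V y +
        ((- V x) * U y + U y * V y)))).
      by apply: eq_expect => y; ring.
    by rewrite !expectD !expectZ expect_cst; ring.
  by rewrite !expectD !expectZ expect_cst; ring.
move=> le_pts; rewrite -(@ler_pM2l _ 2)// -!cov2.
by apply: ler_expect => x; apply: ler_expect.
Qed.

(** * Hyperbolic sine and the two-point inequality *)

Lemma ge0_is_derive_le (R : realType) (f df : R -> R) (a b : R) : a <= b ->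
  (forall x, a <= x -> x <= b -> is_derive x 1 f (df x)) ->
  (forall x, a <= x -> x <= b -> 0 <= df x) -> f a <= f b.
Proof.
move=> ab fdf df0.
have [x||x] := @MVT_segment _ f df a b ab.
- by rewrite in_itv /= => /andP[/ltW ? /ltW ?]; exact: fdf.
- apply: derivable_within_continuous => x.
  by rewrite in_itv /= => /andP[ax xb]; have [] := fdf x ax xb.
- rewrite in_itv /= => /andP[ax xb] fE.
  by rewrite -subr_ge0 fE mulr_ge0 ?df0 ?subr_ge0.
Qed.

Definition sinh (R : realType) (x : R) : R := (expR x - expR (- x)) / 2.

Definition cosh (R : realType) (x : R) : R := (expR x + expR (- x)) / 2.

Lemma sinh0 (R : realType) : sinh (0 : R) = 0.
Proof. by rewrite /sinh oppr0 subrr mul0r. Qed.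

Lemma sinhN (R : realType) (x : R) : sinh (- x) = - sinh x.
Proof. by rewrite /sinh opprK -mulNr opprB. Qed.

Lemma is_derive_sinh (R : realType) (x : R) : is_derive x 1 (@sinh R) (cosh x).
Proof.
have -> : @sinh R = (fun z => 2^-1 * (expR z - expR (- z))).
  by apply/funext => z; rewrite /sinh mulrC.
apply: is_derive_eq; rewrite /cosh /GRing.scale /=; ring.
Qed.

Lemma cosh_ge1 (R : realType) (x : R) : 1 <= cosh x.
Proof.
by have := expR_ge1Dx x; have := expR_ge1Dx (- x); rewrite /cosh; lra.
Qed.

Lemma cosh_nondecreasing (R : realType) (x y : R) : 0 <= x -> x <= y ->
  cosh x <= cosh y.
Proof.
move=> x0 xy; rewrite -subr_ge0.
have -> : cosh y - cosh x =
   (expR y - expR x) * (1 - expR (- (x + y))) / 2.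
  by rewrite /cosh opprD expRD !expRN; field; rewrite !gt_eqF ?expR_gt0.
rewrite divr_ge0 // mulr_ge0 // subr_ge0 ?ler_expR // -expR0 ler_expR.
by rewrite oppr_le0 addr_ge0 // (le_trans x0).
Qed.

Lemma le_id_sinh (R : realType) (x : R) : 0 <= x -> x <= sinh x.
Proof.
move=> x0; rewrite -subr_ge0.
rewrite -[leLHS](subrr 0) -[X in X - _](@sinh0 R).
apply: (@ge0_is_derive_le _ (fun z => sinh z - z) (fun z => cosh z - 1)) => //.
  by move=> z _ _; have := is_derive_sinh z; move=> ?; apply: is_derive_eq.
by move=> z _ _; rewrite subr_ge0 cosh_ge1.
Qed.

Lemma sinh_ge0 (R : realType) (x : R) : 0 <= x -> 0 <= sinh x.
Proof. by move=> x0; exact: le_trans x0 (le_id_sinh x0). Qed.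

(** By convexity of sinh on the half-line, the slope sinh x / x of the chord from
    the origin is nondecreasing. *)
Lemma sinh_scale_le (R : realType) (l x : R) : 0 <= l -> l <= 1 -> 0 <= x ->
  sinh (l * x) <= l * sinh x.
Proof.
move=> l0 l1 x0; rewrite -subr_ge0.
pose g z : R := l * sinh z - sinh (l * z).
suff : g 0 <= g x by rewrite /g !(mulr0, sinh0) subrr.
pose dg z : R := l * (cosh z - cosh (l * z)).
apply: (@ge0_is_derive_le _ g dg) => // z z0 _.
  have ? := is_derive_sinh z.
  have ? : is_derive z 1 (fun z => sinh (l * z)) (cosh (l * z) * l).
    apply: (@is_derive1_comp _ (@sinh R) (fun z => l * z)).
      exact: is_derive_sinh.
    by apply: is_derive_eq; rewrite /GRing.scale /=; ring.
  by apply: is_derive_eq; rewrite /dg /GRing.scale /=; ring.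
by rewrite mulr_ge0 // subr_ge0 cosh_nondecreasing ?mulr_ge0 // ler_piMl.
Qed.

(** One of the two factors on the right absorbs sinh (q u) / q by the
    monotonicity of sinh x / x and the other one is bounded below by its
    argument.  For 0 < q the first factor is sinh u, since q <= 1; for q < 0 it
    is sinh ((1 - q) u), since - q <= 1 - q. *)
Lemma sinh_product_ge (R : realType) (q u : R) : q < 1 -> q != 0 -> 0 <= u ->
  (1 - q) * u * (sinh (q * u) / q) <= sinh u * sinh ((1 - q) * u).
Proof.
move=> q1 q0 u0.
have q1' : 0 < 1 - q by rewrite subr_gt0.
have u1 : 0 <= (1 - q) * u by rewrite mulr_ge0 // ltW.
have [qpos|qneg|/eqP] := ltgtP 0 q; last by rewrite eq_sym (negPf q0).
  rewrite mulrC; apply: ler_pM => //.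
  - by rewrite divr_ge0 ?(ltW qpos) // sinh_ge0 // mulr_ge0 // ltW.
  - by rewrite ler_pdivrMr // [leRHS]mulrC sinh_scale_le // ltW.
  - exact: le_id_sinh.
pose k := - q; pose l := k / (1 - q).
have k0 : 0 < k by rewrite oppr_gt0.
have -> : sinh (q * u) / q = sinh (k * u) / k.
  by rewrite mulNr sinhN invrN mulrNN.
have lE : k * u = l * ((1 - q) * u) by rewrite /l /k; field; rewrite gt_eqF.
have l0 : 0 <= l by rewrite divr_ge0 // ltW.
have l1 : l <= 1 by rewrite ler_pdivrMr // /k; lra.
have sc := sinh_scale_le l0 l1 u1.
rewrite mulrAC [leRHS]mulrC; apply: ler_pM => //.
- rewrite mulr_ge0 ?(ltW q1') // divr_ge0 ?(ltW k0) // sinh_ge0 //.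
  by rewrite mulr_ge0 // ltW.
- rewrite [leRHS](_ : _ = (1 - q) * (l * sinh ((1 - q) * u) / k)).
    by rewrite ler_pM2l // ler_pM2r ?invr_gt0 // lE.
  by rewrite /l; field; rewrite !gt_eqF.
- exact: le_id_sinh.
Qed.

(** A Stroock-Varopoulos inequality for the values e^x and e^y of a positive
    function.  After factoring out the exponential of q (x + y) / 2, only
    the half-difference of x and y remains. *)
Lemma two_point_comparison (R : realType) (q x y : R) : q < 1 -> q != 0 ->
  (expR (q * x) - expR (q * y)) * ((1 - q) / q * x - (1 - q) / q * y) <=
  (expR x - expR y) * (- expR ((q - 1) * x) - - expR ((q - 1) * y)).
Proof.
move=> q1 q0; wlog yx : x y / y <= x.
  move=> H; have [/H //|/ltW/H] := leP y x.
  by congr (_ <= _); ring.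
pose m := (x + y) / 2; pose u := (x - y) / 2.
have u0 : 0 <= u by rewrite divr_ge0 // subr_ge0.
have diffE k : expR (k * x) - expR (k * y) = 2 * expR (k * m) * sinh (k * u).
  have -> : k * x = k * m + k * u by rewrite /m /u; field.
  have -> : k * y = k * m - k * u by rewrite /m /u; field.
  by rewrite !expRD /sinh; field.
have := diffE 1; rewrite !mul1r => ->.
rewrite diffE -opprD diffE.
have -> : (q - 1) * u = - ((1 - q) * u) by ring.
have -> : expR (q * m) = expR m * expR ((q - 1) * m).
  by rewrite -expRD; congr expR; ring.
rewrite sinhN -subr_ge0.
set E1 := expR m; set E2 := expR _.
have -> : 2 * E1 * sinh u * - (2 * E2 * (- sinh ((1 - q) * u))) -
  2 * (E1 * E2) * sinh (q * u) * ((1 - q) / q * x - (1 - q) / q * y)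
  = 4 * (E1 * E2) * (sinh u * sinh ((1 - q) * u) -
     (1 - q) * u * (sinh (q * u) / q)).
  by rewrite /u; field.
by rewrite mulr_ge0 ?subr_ge0 ?sinh_product_ge // !mulr_ge0 ?expR_ge0.
Qed.

(** * The logarithmic Sobolev inequality *)

Lemma expect_ln_le (R : realType) (P : finProbSpace R) (f : P -> R) :
  (forall x, 0 < f x) -> expect (fun x => ln (f x)) <= ln (expect f).
Proof.
move=> f0; have m0 := expect_gt0 f0; set m := expect f in m0 *.
have le1 x : ln (f x) <= ln m - 1 + m^-1 * f x.
  have := expR_ge1Dx (ln (f x) - ln m).
  by rewrite expRD expRN !lnK ?posrE // mulrC; lra.
apply: le_trans (ler_expect le1) _.
by rewrite expectD expect_cst expectZ mulVf ?gt_eqF // subrK.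
Qed.

(** The two factors on the right are monotone in u in opposite directions, so
    their covariance is nonpositive. *)
Lemma expect_mul_le (R : realType) (P : finProbSpace R) (q : R) (u : P -> R) :
  q <= 1 ->
  expect (fun x => expR (q * u x)) <=
  expect (fun x => expR (u x)) * expect (fun x => expR ((q - 1) * u x)).
Proof.
move=> q1; rewrite -subr_ge0.
(* The sign of a covariance is obtained by comparing it with that of 0 and 0. *)
have := @ler_covariance _ P (fun=> 0) (fun=> 0)
  (fun x => expR (u x)) (fun x => -1 * expR ((q - 1) * u x)).
rewrite !expectZ !expect_cst !mul0r subrr.
rewrite (@eq_expect _ _ _ (fun x => -1 * expR (q * u x))); last first.
  by move=> x; rewrite mulrCA -expRD; congr (_ * expR _); ring.
rewrite expectZ !mulN1r mulrN opprK [X in _ -> _ <= X]addrC; apply => x y.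
rewrite mul0r -mulrBr mulN1r mulrN oppr_ge0.
by have [yx|xy] := leP (u y) (u x); [apply: mulr_ge0_le0|apply: mulr_le0_ge0];
  rewrite ?subr_ge0 ?subr_le0 ler_expR ?ler_wnM2l ?subr_le0 // ltW.
Qed.

(** With h = exp u, this bounds the entropy of h ^ q.  Jensen's inequality gives
    Ent g <= Cov (g, ln g), which is compared with - Cov (h, h ^ (q - 1)) by
    [two_point_comparison]. *)
Lemma log_sobolev (R : realType) (P : finProbSpace R) (q : R) (u : P -> R) :
  q < 1 -> q != 0 ->
  (1 - q) / q ^+ 2 * (q * expect (fun x => expR (q * u x) * u x) -
     expect (fun x => expR (q * u x)) * ln (expect (fun x => expR (q * u x))))
  <= expect (fun x => expR (u x)) * expect (fun x => expR ((q - 1) * u x)) -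
     expect (fun x => expR (q * u x)).
Proof.
move=> q1 q0.
have c0 : 0 <= (1 - q) / q ^+ 2 by rewrite divr_ge0 ?sqr_ge0 // subr_ge0 ltW.
have S0 : 0 < expect (fun x => expR (q * u x)).
  by apply: expect_gt0 => x; exact: expR_gt0.
have jen : q * expect u <= ln (expect (fun x => expR (q * u x))).
  rewrite -expectZ (@eq_expect _ _ _ (fun x => ln (expR (q * u x)))) => [|x].
    by apply: expect_ln_le => x; exact: expR_gt0.
  by rewrite expRK.
have := ler_covariance (fun x y => two_point_comparison (u x) (u y) q1 q0).
rewrite (@eq_expect _ _ (fun x => expR (u x) * _)
  (fun x => -1 * expR (q * u x))); last first.
  by move=> x; rewrite mulrN -expRD mulN1r; congr (- expR _); ring.
rewrite (@eq_expect _ _ (fun x => - _)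
  (fun x => -1 * expR ((q - 1) * u x))); last first.
  by move=> x; rewrite mulN1r.
rewrite (@eq_expect _ _ (fun x => _ * _)
  (fun x => (1 - q) / q * (expR (q * u x) * u x))); last first.
  by move=> x; rewrite mulrCA.
rewrite !expectZ !mulN1r mulrN opprK [leRHS]addrC; apply: le_trans.
set S := expect _ in S0 jen *.
rewrite -subr_ge0.
set T := expect (fun x => expR (q * u x) * u x); set M := expect u.
have -> : (1 - q) / q * T - S * ((1 - q) / q * M) - 
    (1 - q) / q ^+ 2 * (q * T - S * ln S) =
    (1 - q) / q ^+ 2 * (S * (ln S - q * M)).
  by field.
by rewrite mulr_ge0 // mulr_ge0 ?subr_ge0 ?(ltW S0).
Qed.

(** * Monotonicity of the norm along the semigroup *)

Lemma is_derive_expect (R : realType) (P : finProbSpace R) (F : R -> P -> R)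
    (dF : P -> R) (s : R) :
  (forall x, is_derive s 1 (F ^~ x) (dF x)) ->
  is_derive s 1 (fun r => expect (F r)) (expect dF).
Proof.
move=> der.
have -> : (fun r => expect (F r)) = \sum_x (fun r => F r x * mass P x).
  by apply/funext => r; rewrite fct_sumE.
rewrite /expect; elim/big_ind2 : _ => [|*|x _].
- exact: is_derive_cst.
- exact: is_deriveD.
- by apply: is_derive_eq; rewrite scaler0 add0r /GRing.scale /= mulrC.
Qed.

Lemma simple_semigroup_gt0 (R : realType) (P : finProbSpace R) (t : R)
    (f : P -> R) : 0 <= t -> (forall x, 0 < f x) ->
  forall x, 0 < simple_semigroup t f x.
Proof.
move=> t0 f0 x; rewrite simple_semigroupE ltr_wpDr //.
  rewrite mulr_ge0 ?subr_ge0 ?expR_le1 ?oppr_le0 // ltW //.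
  exact: expect_gt0.
by rewrite mulr_gt0 ?expR_gt0.
Qed.

Lemma expect_simple_semigroup (R : realType) (P : finProbSpace R) (t : R)
    (f : P -> R) : expect (simple_semigroup t f) = expect f.
Proof.
under eq_expect => x do rewrite simple_semigroupE.
by rewrite expectD expectZ expect_cst; ring.
Qed.

(** H s is the logarithm of the norm of T_s f at exponent q s.  The condition
    q s <> 0 keeps H differentiable, and c < 1 makes room for the times t
    exceeding the critical one. *)
Lemma log_norm_flow (R : realType) (P : finProbSpace R) (f : P -> R)
    (p c t : R) (q := fun s => 1 - (1 - p) * expR (c * s))
    (H := fun s =>
       ln (expect (fun x => expR (q s * ln (simple_semigroup s f x)))) / q s) :
  (forall x, 0 < f x) -> p < 1 -> 0 <= c -> c <= 1 -> 0 <= t ->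
  (forall s, 0 <= s -> s <= t -> q s != 0) -> H 0 <= H t.
Proof.
move=> f0 p1 c0 c1 t0 qN0.
(* X and Y are the entropy side and the energy side of [log_sobolev] for T_s f
   at exponent q s. *)
pose u s x := ln (simple_semigroup s f x).
pose S s := expect (fun x => expR (q s * u s x)).
pose T s := expect (fun x => expR (q s * u s x) * u s x).
pose Y s := expect f * expect (fun x => expR ((q s - 1) * u s x)) - S s.
pose X s := (1 - q s) / q s ^+ 2 * (q s * T s - S s * ln (S s)).
have q1 s : q s < 1 by rewrite /q gtrBl mulr_gt0 ?expR_gt0 ?subr_gt0.
have S0 s : 0 < S s by apply: expect_gt0 => x; exact: expR_gt0.
have uK s x : 0 <= s -> expR (u s x) = simple_semigroup s f x.
  by move=> s0; rewrite /u lnK // posrE simple_semigroup_gt0.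
have uM s : 0 <= s -> expect (fun x => expR (u s x)) = expect f.
  move=> s0; under eq_expect => x do rewrite uK //.
  exact: expect_simple_semigroup.
apply: (@ge0_is_derive_le _ H (fun s => (S s)^-1 * (Y s - c * X s))) => //.
  move=> s s0 st; have qs0 := qN0 s s0 st.
  have dq : is_derive s 1 q (- c * (1 - q s)).
    by apply: is_derive_eq; rewrite /q /GRing.scale /=; ring.
  pose dS x := expR (q s * u s x) * (- c * (1 - q s) * u s x
     - q s * (1 - expect f * expR (- u s x))).
  have dSP x : is_derive s 1 (fun s => expR (q s * u s x)) (dS x).
    have du : is_derive s 1 (u ^~ x) (- (1 - expect f * expR (- u s x))).
      have g0 : 0 < simple_semigroup s f x by exact: simple_semigroup_gt0.
      have dT : is_derive s 1 (fun s => simple_semigroup s f x)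
          (- (simple_semigroup s f x - expect f)).
        have -> : (fun s => simple_semigroup s f x) =
           (fun s => expR (- s) * f x + (1 - expR (- s)) * expect f).
          by apply/funext => r; rewrite simple_semigroupE.
        by apply: is_derive_eq; rewrite simple_semigroupE /GRing.scale /=; ring.
      have dL := is_derive1_ln g0.
      have := @is_derive1_comp _ (@ln R) (fun s => simple_semigroup s f x) s
        _ _ dL dT.
      congr is_derive.
      by rewrite expRN uK //; field; rewrite gt_eqF.
    have := @is_derive1_comp _ expR (fun r => q r * u r x) s _ _
      (is_derive_expR _) (is_deriveM dq du).
    congr is_derive.
    by rewrite /dS /GRing.scale /=; ring.
  have dSE := is_derive_expect dSP.
  have dln : is_derive s 1 (fun s => ln (S s)) ((S s)^-1 * expect dS).
    by apply: (@is_derive1_comp _ (@ln R) S); exact: is_derive1_ln.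
  have dqV : is_derive s 1 (fun s => (q s)^-1)
      (- (q s) ^- 2 * (- c * (1 - q s))).
    exact: is_deriveV.
  have -> : (S s)^-1 * (Y s - c * X s) =
      ln (S s) * (- (q s) ^- 2 * (- c * (1 - q s))) +
      (q s)^-1 * ((S s)^-1 * expect dS).
    have -> : expect dS = - c * (1 - q s) * T s - q s *
        (S s - expect f * expect (fun x => expR ((q s - 1) * u s x))).
      transitivity (expect (fun x =>
          - c * (1 - q s) * (expR (q s * u s x) * u s x) +
          (- q s * expR (q s * u s x) +
           (q s * expect f) * expR ((q s - 1) * u s x)))).
        apply: eq_expect => x; rewrite /dS.
        have -> : (q s - 1) * u s x = q s * u s x + - u s x by ring.
        by rewrite expRD; ring.
      by rewrite !(expectD, expectZ) /T /S; ring.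
    by rewrite /X /Y; field; rewrite qs0 gt_eqF.
  exact: is_deriveM.
move=> s s0 st.
rewrite mulr_ge0 ?invr_ge0 ?(ltW (S0 s)) // subr_ge0.
have Y0 : 0 <= Y s by rewrite subr_ge0 -(uM s s0) expect_mul_le // ltW.
have XY : X s <= Y s by rewrite /Y -(uM s s0) log_sobolev // qN0.
by apply: le_trans (_ : c * Y s <= _); [exact: ler_wpM2l | rewrite ler_piMl].
Qed.

(** * Reverse hypercontractivity on a single space *)

Lemma pnorm_gt0 (R : realType) (P : finProbSpace R) (p : R) (f : P -> R) :
  (forall x, 0 < f x) -> 0 < pnorm p f.
Proof.
move=> f0; rewrite /pnorm; case: eqP => _; first exact: expR_gt0.
by rewrite powR_gt0 // expect_gt0 // => x; rewrite powR_gt0.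
Qed.

Lemma pnormE (R : realType) (P : finProbSpace R) (p : R) (f : P -> R) :
  p != 0 -> (forall x, 0 < f x) ->
  pnorm p f = expR (ln (expect (fun x => expR (p * ln (f x)))) / p).
Proof.
move=> p0 f0; have powE x : f x `^ p = expR (p * ln (f x)).
  by rewrite /powR gt_eqF.
rewrite /pnorm (negPf p0) (eq_expect powE) /powR gt_eqF.
  by rewrite mulrC.
by apply: expect_gt0 => x; exact: expR_gt0.
Qed.

(** The logarithm of the norm at exponent p is the difference quotient at 0 of
    the cumulant generating function ln E (f ^ p). *)
Lemma cvg_pnorm0 (R : realType) (P : finProbSpace R) (f : P -> R) :
  (forall x, 0 < f x) -> (pnorm p f @[p --> 0^'] --> pnorm 0 f)%classic.
Proof.
move=> f0.
pose S p := expect (fun x => expR (p * ln (f x))).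
have S1 : S 0 = 1.
  rewrite /S; under eq_expect => x do rewrite mul0r expR0.
  exact: expect_cst.
have dS : is_derive (0 : R) 1 S (expect (fun x => ln (f x))).
  apply: is_derive_expect => x; apply: is_derive_eq.
  by rewrite mul0r expR0 /GRing.scale /=; ring.
have dln : is_derive (0 : R) 1 (fun p => ln (S p)) (expect (fun x => ln (f x))).
  have S0 : 0 < S 0 by rewrite S1.
  have := @is_derive1_comp _ (@ln R) S 0 _ _ (is_derive1_ln S0) dS.
  by rewrite S1 invr1 mul1r.
have -> : pnorm 0 f = expR (expect (fun x => ln (f x))) by rewrite /pnorm eqxx.
have lim : (expR (p^-1 * (ln (S p) - ln (S 0))) @[p --> 0^'] -->
    expR (expect (fun x => ln (f x))))%classic.
  apply: continuous_cvg; first exact: continuous_expR.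
  have [dl lE] := dln; rewrite -lE.
  apply: cvg_trans dl; apply: near_eq_cvg; apply: nearW => h /=.
  by rewrite addr0 /GRing.scale /= mulr1.
apply: cvg_trans lim; apply: near_eq_cvg; near=> p.
have p0 : p != 0 by near: p; exact: nbhs_dnbhs_neq.
by rewrite S1 ln1 subr0 mulrC -pnormE.
Unshelve. all: by end_near. Qed.

Lemma simple_reverse_hypercontractive_same_sign (R : realType)
    (P : finProbSpace R) (q p t : R) (f : P -> R) :
  q < p -> p < 1 -> (p < 0) || (0 < q) -> (forall x, 0 < f x) ->
  ln ((1 - q) / (1 - p)) <= t ->
  pnorm p f <= pnorm q (simple_semigroup t f).
Proof.
move=> qp p1 sgn f0 tge.
have p1' : 0 < 1 - p by rewrite subr_gt0.
have ratio : 1 < (1 - q) / (1 - p) by rewrite ltr_pdivlMr //; lra.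
have l0 := ln_gt0 ratio; have t0 := lt_le_trans l0 tge.
(* With this speed the exponent goes from p to q in time exactly t. *)
pose c := ln ((1 - q) / (1 - p)) / t.
have c0 : 0 <= c by rewrite divr_ge0 ?ltW.
have c1 : c <= 1 by rewrite ler_pdivrMr // mul1r.
have qt : 1 - (1 - p) * expR (c * t) = q.
  rewrite /c divfK ?gt_eqF // lnK ?posrE ?(lt_trans _ ratio) //.
  by field; rewrite gt_eqF.
have q0E : 1 - (1 - p) * expR (c * 0) = p by rewrite mulr0 expR0; ring.
have Tf0 := simple_semigroup_gt0 (ltW t0) f0.
have pN0 : p != 0.
  by case/orP: sgn => [pn|q0]; [rewrite lt_eqF | rewrite gt_eqF ?(lt_trans q0)].
have qN0 : q != 0.
  by case/orP: sgn => [pn|q0]; [rewrite lt_eqF ?(lt_trans qp) | rewrite gt_eqF].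
rewrite [leLHS](pnormE pN0 f0) [leRHS](pnormE qN0 Tf0) ler_expR.
have := @log_norm_flow _ P f p c t f0 p1 c0 c1 (ltW t0).
rewrite /= q0E qt.
have -> : simple_semigroup 0 f = f.
  by apply/funext => x; rewrite simple_semigroupE oppr0 expR0; ring.
apply => s s0 st.
have qs : q <= 1 - (1 - p) * expR (c * s).
  by rewrite -[leLHS]qt lerD2l lerN2 ler_pM2l // ler_expR ler_wpM2l.
have sp : 1 - (1 - p) * expR (c * s) <= p.
  by rewrite -[leRHS]q0E lerD2l lerN2 ler_pM2l // ler_expR ler_wpM2l.
case/orP: sgn => [pn|qp0]; first by rewrite lt_eqF // (le_lt_trans sp).
by rewrite gt_eqF // (lt_le_trans qp0).
Qed.

Lemma simple_semigroupD (R : realType) (P : finProbSpace R) (s t : R)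
    (f : P -> R) :
  simple_semigroup (s + t) f = simple_semigroup s (simple_semigroup t f).
Proof.
apply/funext => x; rewrite [RHS]simple_semigroupE expect_simple_semigroup.
by rewrite !simple_semigroupE opprD expRD; ring.
Qed.

(** The exponent 0, where the flow argument breaks down, is reached by a limit
    from the side on which the flow runs.  This costs no time, since shrinking the
    interval of exponents only lowers the critical time. *)
Lemma simple_reverse_hypercontractive (R : realType)
    (P : finProbSpace R) (q p t : R) (f : P -> R) :
  q < p -> p < 1 -> (forall x, 0 < f x) ->
  ln ((1 - q) / (1 - p)) <= t ->
  pnorm p f <= pnorm q (simple_semigroup t f).
Proof.
have lnE a b : a < 1 -> b < 1 ->
    ln ((1 - a) / (1 - b)) = ln (1 - a) - ln (1 - b) :> R.
  by move=> a1 b1; rewrite ln_div // posrE subr_gt0.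
have to0 q' t' (g : P -> R) :
    q' < 0 -> (forall x, 0 < g x) -> ln (1 - q') <= t' ->
    pnorm 0 g <= pnorm q' (simple_semigroup t' g).
  move=> q0 g0 tge.
  apply: (cvgr_to_le (cvg_dnbhs_at_left (cvg_pnorm0 g0))).
  near=> p'.
  have p0 : p' < 0 by near: p'; exact: nbhs_left_lt.
  have qp : q' < p' by near: p'; exact: nbhs_left_gt.
  apply: simple_reverse_hypercontractive_same_sign => //;
    rewrite ?p0 ?(lt_trans p0) //.
  rewrite lnE ?(lt_trans q0) ?(lt_trans p0) //.
  by have := ln_ge0 (_ : 1 <= 1 - p'); lra.
have from0 p' t' (g : P -> R) :
    0 < p' -> p' < 1 -> (forall x, 0 < g x) -> - ln (1 - p') <= t' ->
    pnorm p' g <= pnorm 0 (simple_semigroup t' g).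
  move=> p0 p1 g0 tge.
  have t0 : 0 <= t'.
    by apply: le_trans tge; rewrite oppr_ge0 ln_le0 //; lra.
  have Tg0 := simple_semigroup_gt0 t0 g0.
  apply: (cvgr_to_ge (cvg_dnbhs_at_right (cvg_pnorm0 Tg0))).
  near=> q'.
  have q0 : 0 < q' by near: q'; exact: nbhs_right_gt.
  have qp : q' < p' by near: q'; exact: nbhs_right_lt.
  apply: simple_reverse_hypercontractive_same_sign => //; rewrite ?q0 ?orbT //.
  rewrite lnE ?(lt_trans qp) //.
  by have := ln_le0 (_ : 1 - q' <= 1); lra.
move=> qp p1 f0 tge.
have q1 := lt_trans qp p1.
have [pn|pp|pE] := ltgtP p 0.
- by apply: simple_reverse_hypercontractive_same_sign; rewrite ?pn.
- have [qn|qpos|qE] := ltgtP q 0.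
  + (* The time that the flow takes from exponent p to exponent 0. *)
    pose s := - ln (1 - p).
    have s0 : 0 <= s by rewrite oppr_ge0 ln_le0 //; lra.
    rewrite -(subrK s t) simple_semigroupD.
    apply: le_trans (from0 _ s _ pp p1 f0 (lexx _)) (to0 _ _ _ qn _ _).
      exact: simple_semigroup_gt0.
    by move: tge; rewrite lnE // /s; lra.
  + by apply: simple_reverse_hypercontractive_same_sign; rewrite ?qpos ?orbT.
  + rewrite qE; apply: from0 => //.
    by move: tge; rewrite lnE // qE subr0 ln1 sub0r.
- rewrite pE; apply: to0 => //; first by rewrite -pE.
  by move: tge; rewrite lnE // pE subr0 ln1 subr0.
Unshelve. all: by end_near. Qed.

(** * Reverse Hoelder inequality and duality *)

(** Beyond the segment between a and b, a convex function is above the line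
    through its values at a and b; the proof uses the tangent at a. *)
Lemma expR_affine_ge (R : realType) (l a b : R) : 1 <= l ->
  l * expR a + (1 - l) * expR b <= expR (l * a + (1 - l) * b).
Proof.
move=> l1; set c := l * a + _.
have tangent z : expR a * (1 + (z - a)) <= expR z.
  have := expR_ge1Dx (z - a); rewrite expRD expRN ler_pdivlMr ?expR_gt0 //.
  by rewrite mulrC.
have := tangent c; have := ler_wpM2l (_ : 0 <= l - 1) (tangent b).
rewrite subr_ge0 => /(_ l1) tb tc.
have -> : l * expR a =
    expR a * (1 + (c - a)) + (l - 1) * (expR a * (1 + (b - a))).
  by rewrite /c; ring.
by apply: le_trans (_ : _ <= expR c + (l - 1) * expR b + (1 - l) * expR b) _;
  [rewrite lerD2r lerD | rewrite -addrA -mulrDl; lra].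
Qed.

Lemma expR_affine_ge_out (R : realType) (q a b : R) : q < 1 -> q != 0 ->
  q^-1 * expR a + (1 - q^-1) * expR b <= expR (q^-1 * a + (1 - q^-1) * b).
Proof.
move=> q1 q0; have [qp|qn|qE] := ltgtP 0 q; last by rewrite -qE eqxx in q0.
  by apply: expR_affine_ge; rewrite invf_ge1 // ltW.
rewrite addrC [X in _ <= expR X]addrC.
have := @expR_affine_ge R (1 - q^-1) b a; rewrite subKr; apply.
by rewrite lerDl oppr_ge0 invr_le0 ltW.
Qed.

(** Young's inequality is reversed because one of the weights 1 / q and 1 - 1 / q
    is negative; it is applied to functions normalised to have norm 1.  At q = 0
    both exponents are 0 and the inequality is Jensen's for the logarithm. *)
Lemma reverse_hoelder (R : realType) (P : finProbSpace R) (q : R)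
    (g h : P -> R) :
  q < 1 -> (forall x, 0 < g x) -> (forall x, 0 < h x) ->
  pnorm (q / (q - 1)) g * pnorm q h <= expect (fun x => g x * h x).
Proof.
move=> q1 g0 h0.
have gh0 x : 0 < g x * h x by rewrite mulr_gt0.
have [qE|qN0] := eqVneq q 0.
  rewrite qE mul0r /pnorm eqxx -expRD -expectD.
  rewrite -[leRHS]lnK ?posrE ?expect_gt0 // ler_expR.
  apply: le_trans (expect_ln_le gh0).
  by apply: ler_expect => x; rewrite lnM ?posrE.
have q1N : q - 1 != 0 by rewrite subr_eq0 lt_eqF.
have rN0 : q / (q - 1) != 0 by rewrite mulf_neq0 ?invr_eq0.
set r := q / (q - 1) in rN0 *.
rewrite [X in X * _ <= _](pnormE rN0 g0).
rewrite [X in _ * X <= _](pnormE qN0 h0) -expRD.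
pose A := expect (fun x => expR (q * ln (h x))).
pose B := expect (fun x => expR (r * ln (g x))).
have A0 : 0 < A by apply: expect_gt0 => x; exact: expR_gt0.
have B0 : 0 < B by apply: expect_gt0 => x; exact: expR_gt0.
have expR_subln a b : 0 < b -> expR (a - ln b) = b^-1 * expR a.
  by move=> b0; rewrite expRD expRN lnK ?posrE // mulrC.
have young x : q^-1 * (A^-1 * expR (q * ln (h x))) +
    (1 - q^-1) * (B^-1 * expR (r * ln (g x))) <=
    expR (- (ln B / r + ln A / q)) * (g x * h x).
  have := @expR_affine_ge_out R q
    (q * ln (h x) - ln A) (r * ln (g x) - ln B) q1 qN0.
  rewrite !expR_subln //.
  have -> : q^-1 * (q * ln (h x) - ln A) + (1 - q^-1) * (r * ln (g x) - ln B) =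
      ln (g x) + ln (h x) - (ln B / r + ln A / q).
    by rewrite /r; field; rewrite qN0 q1N.
  rewrite expRD [expR (ln (g x) + _)]expRD !lnK ?posrE //.
  by rewrite [g x * h x * _]mulrC.
have := ler_expect young.
rewrite expectD !expectZ -/A -/B !mulVf ?gt_eqF // !mulr1 addrC subrK.
by rewrite expRN ler_pdivlMl ?expR_gt0 // mulr1.
Qed.

(** The reverse Hoelder inequality for h is an equality at g = h ^ (q - 1), so the
    norm of h is the infimum of E (g h) over g of norm 1 at the conjugate
    exponent. *)
Lemma pnorm_ge_dual (R : realType) (P : finProbSpace R) (q N : R) (h : P -> R) :
  q < 1 -> (forall x, 0 < h x) ->
  (forall g : P -> R, (forall x, 0 < g x) ->
     pnorm (q / (q - 1)) g * N <= expect (fun x => g x * h x)) ->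
  N <= pnorm q h.
Proof.
move=> q1 h0 dual.
pose g x := expR ((q - 1) * ln (h x)).
have g0 x : 0 < g x by exact: expR_gt0.
have := dual g g0.
have -> : expect (fun x => g x * h x) = expect (fun x => expR (q * ln (h x))).
  apply: eq_expect => x; rewrite /g -[X in _ * X](@lnK _ (h x)) ?posrE // -expRD.
  by congr expR; ring.
set A := expect _.
have A0 : 0 < A by apply: expect_gt0 => x; exact: expR_gt0.
rewrite mulrC -ler_pdivlMr ?pnorm_gt0 //; move/le_trans; apply.
have [qE|qN0] := eqVneq q 0.
  have -> : A = 1.
    rewrite /A qE; under eq_expect => x do rewrite mul0r expR0.
    exact: expect_cst.
  rewrite /g qE mul0r /pnorm eqxx div1r -expRN ler_expR.
  under eq_expect => x do rewrite expRK.
  by rewrite expectZ; lra.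
have q1N : q - 1 != 0 by rewrite subr_eq0 lt_eqF.
have rN0 : q / (q - 1) != 0 by rewrite mulf_neq0 ?invr_eq0.
rewrite [leRHS](pnormE qN0 h0) [X in _ / X](pnormE rN0 g0) -/A.
have -> : expect (fun x => expR (q / (q - 1) * ln (g x))) = A.
  by apply: eq_expect => x; rewrite /g expRK mulrA divfK.
rewrite -[X in X / _](@lnK _ A) ?posrE // -expRN -expRD ler_expR.
apply: le_of_eq; field.
by rewrite qN0 q1N.
Qed.

(** * Splitting off the first coordinate of a product *)

(** [unliftP] supplies the equation along which the coordinate is transported,
    as the type of a coordinate depends on its index. *)
Definition cons_point (R : realType) (n : nat) (P : 'I_n.+1 -> finProbSpace R)
    (x : P ord0) (w : prod_space (fun i => P (lift ord0 i))) : prod_space P :=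
  [ffun i => match unliftP ord0 i with
             | UnliftSome j ij => eq_rect_r (fun k => P k : Type) (w j) ij
             | UnliftNone i0 => eq_rect_r (fun k => P k : Type) x i0
             end].

Lemma cons_point0 (R : realType) (n : nat) (P : 'I_n.+1 -> finProbSpace R)
    (x : P ord0) (w : prod_space (fun i => P (lift ord0 i))) :
  cons_point x w ord0 = x.
Proof.
rewrite ffunE; case: unliftP => [j e|e].
  by exfalso; move: (neq_lift ord0 j); rewrite -e eqxx.
by rewrite (eq_axiomK e).
Qed.

Lemma cons_pointS (R : realType) (n : nat) (P : 'I_n.+1 -> finProbSpace R)
    (x : P ord0) (w : prod_space (fun i => P (lift ord0 i))) j :
  cons_point x w (lift ord0 j) = w j.
Proof.
rewrite ffunE; case: unliftP => [k e|e]; last first.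
  by exfalso; move: (neq_lift ord0 j); rewrite e eqxx.
have jk := lift_inj e; case: _ / jk e => e.
by rewrite (eq_axiomK e).
Qed.

Lemma sum_cons_point (R : realType) (n : nat) (P : 'I_n.+1 -> finProbSpace R)
    (F : prod_space P -> R) :
  \sum_v F v =
  \sum_(x : P ord0) \sum_(w : prod_space (fun i => P (lift ord0 i)))
    F (cons_point x w).
Proof.
rewrite pair_big /=.
rewrite (reindex (fun u : P ord0 * prod_space (fun i => P (lift ord0 i)) =>
  cons_point u.1 u.2)) //=.
exists (fun v : prod_space P => (v ord0, [ffun i => v (lift ord0 i)]))
  => [[x w] _|v _] /=.
  rewrite cons_point0; congr pair.
  by apply/ffunP => i; rewrite ffunE cons_pointS.
apply/ffunP => i; have [j ->|->] := unliftP ord0 i.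
  by rewrite cons_pointS ffunE.
by rewrite cons_point0.
Qed.

Lemma mass_cons_point (R : realType) (n : nat) (P : 'I_n.+1 -> finProbSpace R)
    (x : P ord0) (w : prod_space (fun i => P (lift ord0 i))) :
  mass (prod_space P) (cons_point x w) =
  mass (P ord0) x * mass (prod_space (fun i => P (lift ord0 i))) w.
Proof.
rewrite /= /prod_mass big_ord_recl cons_point0; congr (_ * _).
by apply: eq_bigr => i _; rewrite cons_pointS.
Qed.

Lemma expect_cons_point (R : realType) (n : nat) (P : 'I_n.+1 -> finProbSpace R)
    (f : prod_space P -> R) :
  expect f = expect (fun x => expect (fun w => f (cons_point x w))).
Proof.
rewrite {1}/expect sum_cons_point; apply: eq_bigr => x _.
rewrite /expect mulr_suml; apply: eq_bigr => w _.
by rewrite mass_cons_point mulrCA mulrC -mulrA mulrCA mulrA.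
Qed.

Lemma pnorm_cons_point (R : realType) (n : nat) (P : 'I_n.+1 -> finProbSpace R)
    (p : R) (f : prod_space P -> R) : (forall v, 0 < f v) ->
  pnorm p f = pnorm p (fun x => pnorm p (fun w => f (cons_point x w))).
Proof.
move=> f0; rewrite /pnorm; case: eqP => [_|/eqP p0].
  rewrite expect_cons_point; congr expR.
  by apply: eq_expect => x; rewrite expRK.
rewrite expect_cons_point; congr powR; apply: eq_expect => x.
rewrite -powRrM mulVf // powRr1 // ltW // expect_gt0 // => w.
by rewrite powR_gt0.
Qed.

Lemma pnorm_cst (R : realType) (P : finProbSpace R) (p c : R) : 0 < c ->
  pnorm p (fun _ : P => c) = c.
Proof.
move=> c0; rewrite /pnorm !expect_cst; case: eqP => [_|/eqP p0].
  by rewrite lnK.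
by rewrite -powRrM mulfV // powRr1 // ltW.
Qed.

(** * Bilinear inequalities on products *)

(** For K x y = A (indic_pt x) y * mass y, the double sum is E (g A f), and for
    r conjugate to q this is the dual form of N(p, f) <= N(q, A f). *)
Definition reverse_bilinear (R : realType) (P : finProbSpace R)
    (K : P -> P -> R) (p r : R) :=
  forall f g : P -> R, (forall x, 0 < f x) -> (forall x, 0 < g x) ->
  pnorm p f * pnorm r g <= \sum_x \sum_y K x y * (f x * g y).

(** With the first coordinates of both arguments frozen, the induction hypothesis
    bounds the sum over the remaining coordinates by a product of partial norms;
    the inequality for the first coordinate applies to these partial norms, whose
    norms are the full ones. *)
Lemma reverse_bilinear_prod (R : realType) (n : nat)
    (P : 'I_n -> finProbSpace R)
    (K : forall i, P i -> P i -> R) (p r : R) :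
  (forall i x y, 0 <= K i x y) ->
  (forall i, reverse_bilinear (@K i) p r) ->
  @reverse_bilinear R (prod_space P) (fun v w => \prod_i K i (v i) (w i)) p r.
Proof.
elim: n P K => [|n IH] P K K0 revK f g f0 g0.
  (* The empty product has a single point, so f and g are constant. *)
  pose o : prod_space P :=
    [ffun i : 'I_0 => let: Ordinal _ i0 := i in False_rect _ (notF i0)].
  have all_o (v : prod_space P) : v = o by apply/ffunP => -[].
  have -> : f = fun=> f o by apply/funext => v; rewrite (all_o v).
  have -> : g = fun=> g o by apply/funext => v; rewrite (all_o v).
  rewrite !pnorm_cst //.
  have -> : \sum_(x : prod_space P) \sum_(y : prod_space P)
      (\prod_i K i (x i) (y i)) * (f o * g o) =
    \sum_(x : prod_space P) \sum_(y : prod_space P)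
      (f o * g o * mass (prod_space P) x) * mass (prod_space P) y.
    apply: eq_bigr => x _; apply: eq_bigr => y _.
    by rewrite /= /prod_mass !big_ord0 mul1r !mulr1.
  under eq_bigr => x _ do rewrite -mulr_sumr mass_sum1 mulr1.
  by rewrite -mulr_sumr mass_sum1 mulr1.
pose P' i := P (lift ord0 i); pose K' i := K (lift ord0 i).
have IH' := IH P' K' (fun i => K0 (lift ord0 i)) (fun i => revK (lift ord0 i)).
rewrite (pnorm_cons_point p f0) (pnorm_cons_point r g0).
have f0' x : 0 < pnorm p (fun w => f (cons_point x w)) by exact: pnorm_gt0.
have g0' x : 0 < pnorm r (fun w => g (cons_point x w)) by exact: pnorm_gt0.
apply: le_trans (revK ord0 _ _ f0' g0') _.
rewrite sum_cons_point; apply: ler_sum => x _.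
under [leRHS]eq_bigr => v _ do rewrite sum_cons_point.
rewrite exchange_big /=; apply: ler_sum => y _.
apply: le_trans (_ : _ <= K ord0 x y *
  \sum_(v : prod_space P') \sum_(w : prod_space P')
   (\prod_i K' i (v i) (w i)) * (f (cons_point x v) * g (cons_point y w))) _.
  rewrite ler_wpM2l // IH' //.
rewrite mulr_sumr; apply: ler_sum => v _.
rewrite mulr_sumr; apply: ler_sum => w _.
rewrite big_ord_recl !cons_point0 mulrA.
apply: le_of_eq; congr (_ * _ * _).
by apply: eq_bigr => i _; rewrite !cons_pointS.
Qed.

(** * The simple semigroup and its tensor products *)

(** This is linearity, applied to the expansion of f on indicators. *)
Lemma simple_semigroup_kernel (R : realType) (P : finProbSpace R) (t : R)
    (f : P -> R) (y : P) :
  \sum_x f x * simple_semigroup t (indic_pt R x) y = simple_semigroup t f y.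
Proof.
have expect_indic x : expect (indic_pt R x : P -> R) = mass P x.
  rewrite /expect (bigD1 x) //= big1 /indic_pt ?eqxx ?mul1r ?addr0 // => z zx.
  by rewrite (negPf zx) mul0r.
rewrite simple_semigroupE [in RHS]/expect mulr_sumr.
rewrite (eq_bigr (fun x => expR (- t) * (f x * (y == x)%:R) +
    (1 - expR (- t)) * (f x * mass P x))) => [|x _]; last first.
  by rewrite simple_semigroupE expect_indic /indic_pt; ring.
rewrite big_split /= -mulr_sumr (bigD1 y) //= big1 => [|x xy].
  by rewrite eqxx mulr1 addr0.
by rewrite eq_sym (negPf xy) mulr0.
Qed.

Lemma simple_semigroup_indic_gt0 (R : realType) (P : finProbSpace R) (t : R)
    (x y : P) : 0 < t -> 0 < simple_semigroup t (indic_pt R x) y.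
Proof.
move=> t0; rewrite simple_semigroupE ltr_wpDl //.
  by rewrite mulr_ge0 ?expR_ge0 // ler0n.
rewrite mulr_gt0 ?subr_gt0 ?expR_lt1 ?oppr_lt0 //.
rewrite /expect (bigD1 x) //= /indic_pt eqxx mul1r ltr_pwDl ?mass_gt0 //.
by apply: sumr_ge0 => z _; rewrite mulr_ge0 ?ler0n // ltW ?mass_gt0.
Qed.

Lemma simple_reverse_bilinear (R : realType) (P : finProbSpace R) (q p t : R) :
  q < p -> p < 1 -> ln ((1 - q) / (1 - p)) <= t -> 0 < t ->
  @reverse_bilinear R P
    (fun x y => simple_semigroup t (indic_pt R x) y * mass P y) p (q / (q - 1)).
Proof.
move=> qp p1 tge t0 f g f0 g0.
have Tf0 := simple_semigroup_gt0 (ltW t0) f0.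
have hyp := simple_reverse_hypercontractive qp p1 f0 tge.
rewrite mulrC; apply: le_trans (ler_wpM2l (ltW (pnorm_gt0 _ g0)) hyp) _.
apply: le_trans (reverse_hoelder (lt_trans qp p1) g0 Tf0) _.
rewrite exchange_big /=; apply: le_of_eq.
apply: eq_bigr => y _; rewrite -simple_semigroup_kernel mulr_sumr mulr_suml.
by apply: eq_bigr => x _; ring.
Qed.

Theorem corollary1p11 (R : realType) :
  (forall (P : finProbSpace R) (q p t : R) (f : P -> R),
     q < p -> p < 1 -> (forall x, 0 < f x) ->
     ln ((1 - q) / (1 - p)) <= t ->
     pnorm p f <= pnorm q (simple_semigroup t f)) /\
  (forall (n : nat) (P : 'I_n -> finProbSpace R) (q p t : R)
     (f : prod_space P -> R),
     (0 < n)%N ->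
     q < p -> p < 1 -> (forall x, 0 < f x) ->
     ln ((1 - q) / (1 - p)) <= t ->
     pnorm p f <= pnorm q (tensor_semigroup t f)).
Proof.
split; first exact: simple_reverse_hypercontractive.
move=> n P q p t f _ qp p1 f0 tge.
have t0 : 0 < t.
  apply: lt_le_trans tge; apply: ln_gt0.
  by rewrite ltr_pdivlMr ?subr_gt0 //; lra.
pose k i (x y : P i) := simple_semigroup t (indic_pt R x) y.
have k0 i x y : 0 < k i x y by exact: simple_semigroup_indic_gt0.
have Tf0 w : 0 < tensor_semigroup t f w.
  (* Dividing by the masses turns the defining sum into an expectation. *)
  pose h v := f v * \prod_i k i (v i) (w i) / mass (prod_space P) v.
  have -> : tensor_semigroup t f w = expect h.
    by apply: eq_bigr => v _; rewrite divfK // gt_eqF // mass_gt0.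
  apply: expect_gt0 => v.
  by rewrite divr_gt0 ?mass_gt0 // mulr_gt0 // prodr_gt0.
apply: pnorm_ge_dual => //; first exact: lt_trans p1.
move=> g g0; rewrite mulrC.
have rev := @reverse_bilinear_prod R n P
  (fun i x y => k i x y * mass (P i) y) p (q / (q - 1)).
apply: le_trans (rev _ _ f g f0 g0) _.
- by move=> i x y; rewrite mulr_ge0 // ltW // mass_gt0.
- by move=> i; exact: simple_reverse_bilinear.
rewrite exchange_big /=; apply: le_of_eq.
apply: eq_bigr => w _; rewrite mulr_sumr mulr_suml.
apply: eq_bigr => v _; rewrite big_split /=.
by rewrite /prod_mass /k; ring.
Qed.
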